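(* Let $k\ge 1$ be an integer, $n=k(k+1)/2$, and let $\rho_k=(k,k-1,\ldots,2,1)$ be the staircase partition of $n$. Let $\mu$ be a partition of $n$ such that $[\mu](\rho_k)\neq 0$. Then $[\mu]$ is a constituent of the Kronecker square $[\rho_k]^2$.
   Context: For a partition $\mu$ of $n$, $[\mu]$ denotes the irreducible complex character of the symmetric group $S_n$ labelled by $\mu$, and $[\mu](\alpha)$ denotes its value on elements of cycle type $\alpha$. $[\rho_k]^2$ is the pointwise square of the character $[\rho_k]$. *)

(* Defs.v *)
From HB Require Import structures.
From mathcomp Require Import all_boot all_order all_algebra all_fingroup.
From mathcomp Require Import all_solvable all_field all_character.

Set Implicit Arguments.
Unset Strict Implicit.
Unset Printing Implicit Defensive.

Import GroupScope Order.TTheory GRing.Theory Num.Theory.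
Local Open Scope ring_scope.

Definition is_part (n : nat) (mu : seq nat) : bool :=
  [&& sorted geq mu, 0%N \notin mu & sumn mu == n].

Definition staircase (k : nat) : seq nat := rev (iota 1 k).

Definition cycle_type n (s : 'S_n) : seq nat :=
  sort geq [seq #|C| | C : {set 'I_n} <- enum (porbits s)].

(* The tableau of shape [mu] filled row by row with 0, ..., n - 1: the entry
   [x] is in row [tab_row mu x] and column [tab_col mu x], counted from 0. *)
Definition tab_row n (mu : seq nat) (x : 'I_n) : nat := reshape_index mu x.
Definition tab_col n (mu : seq nat) (x : 'I_n) : nat := reshape_offset mu x.

Definition fiber_stab n (f : 'I_n -> nat) : {set 'S_n} :=
  [set s : 'S_n | [forall x, f (s x) == f x]].

Lemma fiber_stabP n (f : 'I_n -> nat) (s : 'S_n) :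
  reflect (forall x, f (s x) = f x) (s \in fiber_stab f).
Proof. by rewrite inE; apply: 'forall_eqP. Qed.

Lemma fiber_stab_group_set n (f : 'I_n -> nat) : group_set (fiber_stab f).
Proof.
apply/group_setP; split=> [|s t /fiber_stabP fs /fiber_stabP ft].
  by apply/fiber_stabP=> x; rewrite perm1.
by apply/fiber_stabP=> x; rewrite permM ft fs.
Qed.
Canonical fiber_stab_group n (f : 'I_n -> nat) :=
  Group (fiber_stab_group_set f).

(* The stabilizers of the rows and of the columns of the tableau; they are
   Young subgroups of type [mu] and of type the conjugate of [mu]. *)
Definition row_stab n mu : {group 'S_n} := [group of fiber_stab (@tab_row n mu)].
Definition col_stab n mu : {group 'S_n} := [group of fiber_stab (@tab_col n mu)].

Fact sgn_mx_repr n :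
  mx_repr [set: 'S_n] (fun s : 'S_n => ((-1) ^+ s)%:M : 'M[algC]_1).
Proof.
split=> [|s t _ _]; first by rewrite odd_perm1.
by rewrite odd_permM signr_addb scalar_mxM.
Qed.
Definition cfSgn n : 'CF([set: 'S_n]) := cfRepr (MxRepresentation (sgn_mx_repr n)).

Lemma cfSgnE n (s : 'S_n) : cfSgn n s = (-1) ^+ s.
Proof. by rewrite cfunE in_setT /= mxtrace_scalar. Qed.

Definition ind_row n mu : 'CF([set: 'S_n]) := 'Ind[[set: 'S_n], row_stab n mu] 1.
Definition ind_col n mu : 'CF([set: 'S_n]) :=
  'Ind[[set: 'S_n], col_stab n mu] ('Res[col_stab n mu] (cfSgn n)).

(* The label of [mu] is the unique common irreducible constituent of these two
   induced characters (James & Kerber, The Representation Theory of the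
   Symmetric Group, section 2.1); [irr_symP] below shows that it exists and is
   unique, so that the default value is never used for a partition of n. *)
Definition irr_sym n (mu : seq nat) : Iirr [set: 'S_n] :=
  odflt 0 [pick i | (i \in irr_constt (ind_row n mu))
                    && (i \in irr_constt (ind_col n mu))].

Section WellDefined.

Variables (n : nat) (row col : 'I_n -> nat).
Hypothesis col_ub : forall x, (col x <= n)%N.
Hypothesis box_inj : injective (fun x => (row x, col x)).
Hypothesis box_up : forall x i, (i <= row x)%N ->
  exists2 y, row y = i & col y = col x.

Let R := [group of fiber_stab row].
Let C := [group of fiber_stab col].

Lemma sum_uniq_iota (s : seq nat) : uniq s ->
  (\sum_(i < size s) (i : nat) <= sumn s ?= iff all (ltn^~ (size s)) s)%N.
Proof.
move: {2}(size s) (erefl (size s)) => m Dm.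
elim: m => [|m IHm] in s Dm * => Us.
  by rewrite (size0nil Dm) big_ord0; split.
have [/allP lt_s | /allPn[x sx]] := boolP (all _ s).
  have sub : {subset s <= iota 0 (size s)}.
    by move=> x /lt_s; rewrite mem_iota.
  have [|_ s_iota] := uniq_min_size Us sub; first by rewrite size_iota.
  have: perm_eq s (iota 0 (size s)) by rewrite uniq_perm ?iota_uniq.
  move/perm_sumn->; rewrite sumnE -[X in iota _ X]subn0 big_mkord.
  by split; rewrite ?eqxx.
rewrite -leqNgt => le_s_x.
rewrite (perm_sumn (perm_to_rem sx)) /= Dm big_ord_recr /=.
have Dr : size (rem x s) = m by rewrite size_rem // Dm.
have /leqifP := IHm _ Dr (rem_uniq x Us); rewrite Dr => le_r.
have {}le_r : (\sum_(i < m) (i : nat) <= sumn (rem x s))%N.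
  by move: le_r; case: ifP => _; [move/eqP-> | move/ltnW].
apply/leqifP; rewrite /= addnC -addSn leq_add //.
by rewrite -Dm.
Qed.

Definition col_fib (x : 'I_n) := [set y | col y == col x].

Lemma sum_col (h : 'I_n -> nat) (x : 'I_n) :
    {in col_fib x &, injective h} ->
  (\sum_(i < #|col_fib x|) (i : nat) <= \sum_(y in col_fib x) h y
     ?= iff [forall y in col_fib x, h y < #|col_fib x|])%N.
Proof.
move=> inj_h; pose s := [seq h y | y <- enum (col_fib x)].
have sz : size s = #|col_fib x| by rewrite size_map -cardE.
have Us : uniq s.
  rewrite map_inj_in_uniq ?enum_uniq // => y z.
  by rewrite !mem_enum; apply: inj_h.
have -> : [forall y in col_fib x, h y < #|col_fib x|]%N
    = all (ltn^~ #|col_fib x|) s.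
  rewrite all_map; apply/forall_inP/allP=> H y Ay.
    by apply: H; rewrite mem_enum in Ay.
  by apply: H; rewrite mem_enum.
by have := sum_uniq_iota Us; rewrite sz sumnE big_map big_enum.
Qed.

Lemma row_bound x y : y \in col_fib x -> (row y < #|col_fib x|)%N.
Proof.
rewrite inE => /eqP Dy.
have /fin_all_exists2[f Df1 Df2] (i : 'I_(row y).+1) :
    exists2 z, row z = i & col z = col y.
  by apply: box_up; rewrite -ltnS.
have inj_f : injective f by move=> i j /(congr1 row); rewrite !Df1 => /val_inj.
rewrite -[X in (X <= _)%N]card_ord -(card_imset _ inj_f) subset_leq_card //.
by apply/subsetP=> _ /imsetP[i _ ->]; rewrite inE Df2 Dy.
Qed.

Lemma col_full x i : (i < #|col_fib x|)%N ->
  exists2 y, row y = i & col y = col x.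
Proof.
move=> lti; pose s := [seq row y | y <- enum (col_fib x)].
have Us : uniq s.
  rewrite map_inj_in_uniq ?enum_uniq // => y z.
  rewrite !mem_enum !inE => /eqP Dy /eqP Dz Er.
  by apply: box_inj; rewrite /= Er Dy Dz.
have sub : {subset s <= iota 0 #|col_fib x|}.
  by move=> _ /mapP[y + ->]; rewrite mem_enum mem_iota; apply: row_bound.
have [|_ s_iota] := uniq_min_size Us sub.
  by rewrite size_iota size_map -cardE.
have: i \in s by rewrite s_iota mem_iota.
case/mapP=> y; rewrite mem_enum inE => /eqP Dy Di; by exists y.
Qed.

Definition transversal (g : 'S_n) := injectiveb (fun x => (row (g x), col x)).

Lemma transversal_bound g x :
  transversal g -> (row (g x) < #|col_fib x|)%N.
Proof.
move/injectiveP=> inj_g.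
pose key (y : 'I_n) : 'I_n.+1 := inord (col y).
have key_eq y z : (key y == key z) = (col y == col z).
  by rewrite -val_eqE /= !inordK // ltnS.
have inj_h z : {in col_fib z &, injective (fun y => row (g y))}.
  by move=> y y'; rewrite !inE => /eqP D /eqP D' E; apply: inj_g; rewrite E D D'.
have inj_r z : {in col_fib z &, injective row}.
  by move=> y y'; rewrite !inE => /eqP D /eqP D' E; apply: box_inj; rewrite /= E D D'.
have le_col z : (\sum_(y in col_fib z) row y <= \sum_(y in col_fib z) row (g y)
    ?= iff [forall y in col_fib z, row (g y) < #|col_fib z|])%N.
  have [_ /esym] := sum_col (@inj_r z).
  have -> : [forall y in col_fib z, row y < #|col_fib z|]%N.
    by apply/forall_inP=> y; apply: row_bound.
  by move/esym/eqP <-; apply: sum_col.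
have Eg : (\sum_y row y = \sum_y row (g y))%N.
  by rewrite (reindex_inj (@perm_inj _ g)).
have sumE (h : 'I_n -> nat) :
    (\sum_y h y = \sum_j \sum_(y | key y == j) h y)%N.
  by rewrite (partition_big key xpredT).
have keyE (h : 'I_n -> nat) z :
    (\sum_(y | key y == key z) h y = \sum_(y in col_fib z) h y)%N.
  by apply: eq_bigl => y; rewrite inE key_eq.
pose ok j := (\sum_(y | key y == j) row y == \sum_(y | key y == j) row (g y))%N.
have le_key j : (\sum_(y | key y == j) row y <=
    \sum_(y | key y == j) row (g y) ?= iff ok j)%N.
  split=> //; have [z /eqP <- | j0] := pickP (fun z => key z == j).
    by rewrite !keyE le_col.
  by rewrite !big_pred0.
have [_] := leqif_sum (fun j (_ : xpredT j) => le_key j).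
rewrite -!sumE Eg eqxx => /esym/forallP/(_ (key x)) /=.
rewrite /ok !keyE (le_col x) => /forall_inP; apply.
by rewrite inE.
Qed.

Lemma transversalE g : transversal g = (g \in (C * R)%g).
Proof.
apply/idP/mulsgP => [tg | [c r /fiber_stabP Cc /fiber_stabP Rr ->]]; last first.
  apply/injectiveP=> x y [] /=; rewrite !permM !Rr -(Cc x) -(Cc y) => Er Ec.
  by apply: (@perm_inj _ c); apply: box_inj; rewrite /= Er Ec.
have /fin_all_exists2[f Df1 Df2] x := col_full (transversal_bound x tg).
have inj_f : injective f.
  move=> x y Exy; apply: (injectiveP _ tg).
  by rewrite /= -!Df1 -(Df2 x) -(Df2 y) Exy.
exists (perm inj_f) ((perm inj_f)^-1 * g)%g; last by rewrite mulKVg.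
  by apply/fiber_stabP=> x; rewrite permE.
apply/fiber_stabP=> x; rewrite permM -Df1.
by rewrite -(permE inj_f) permKV.
Qed.

Lemma stabTI : C :&: R = 1%g.
Proof.
apply/trivgP/subsetP=> s /setIP[/fiber_stabP Cs /fiber_stabP Rs].
by apply/set1gP/permP=> x; rewrite perm1; apply: box_inj; rewrite /= Cs Rs.
Qed.

Lemma sum_sgn g :
  \sum_(q in C | (q ^ g)%g \in R) (-1) ^+ q = (transversal g)%:R :> algC.
Proof.
have inC q : (q \in C) && ((q ^ g)%g \in R) =
    [forall x, (row (g (q x)) == row (g x)) && (col (q x) == col x)].
  apply/andP/forallP=> [[/fiber_stabP Cq /fiber_stabP Rq] x | H].
    have := Rq (g x); rewrite conjgE !permM permK => ->.
    by rewrite Cq !eqxx.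
  split; apply/fiber_stabP=> x; first by case/andP: (H x) => _ /eqP.
  case/andP: (H (g^-1 x)%g) => /eqP; rewrite permKV => <- _.
  by rewrite conjgE !permM.
rewrite (eq_bigl _ _ inC).
have [/injectiveP inj_g | /injectivePn[x [y neq_xy [Er Ec]]]] :=
  boolP (transversal g).
  rewrite (big_pred1 1%g) ?odd_perm1 // => q; apply/forallP/eqP=> [H | -> x].
    apply/permP=> x; rewrite perm1; apply: inj_g.
    by have /andP[/eqP-> /eqP->] := H x.
  by rewrite perm1 !eqxx.
set S := \sum_(q | _) _.
suff: S = - S by move/eqP; rewrite -addr_eq0 -mulr2n mulrn_eq0 => /eqP.
rewrite {1}/S (reindex_inj (mulgI (tperm x y))) /= -sumrN.
have Ht z : (row (g (tperm x y z)) = row (g z)) * (col (tperm x y z) = col z).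
  by case: tpermP => [->|->|].
apply: eq_big => [q | q _]; last first.
  by rewrite odd_permM odd_tperm neq_xy /= signrN.
apply/forallP/forallP=> H z.
  by have := H (tperm x y z); rewrite permM tpermK !Ht.
by have := H (tperm x y z); rewrite permM !Ht.
Qed.

Lemma cfdot_ind_fiber_stab :
  '['Ind[[set: 'S_n], R] 1, 'Ind[[set: 'S_n], C] ('Res[C] (cfSgn n))] = 1.
Proof.
rewrite -cfdot_Res_l cfdotE.
under eq_bigr => q Cq.
  rewrite cfResE ?subsetT // cfResE ?subsetT // cfIndE ?subsetT //.
  rewrite cfSgnE rmorphXn rmorphN1 -mulrA big_distrl /=; over.
rewrite -big_distrr /= exchange_big /=.
under eq_bigr => g _.
  rewrite (_ : \sum_(i in _) _ = (transversal g)%:R); last first.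
    rewrite -sum_sgn big_mkcondr /=; apply: eq_bigr => q Cq.
    by rewrite cfun1E; case: ifP => _; rewrite ?mul1r ?mul0r.
  rewrite transversalE; over.
have card_CR : (\sum_(g in [set: 'S_n]) (g \in (C * R)%g) = #|(C * R)%g|)%N.
  rewrite -sum1_card [RHS]big_mkcond; apply: eq_big => [g | g _].
    by rewrite in_setT.
  by case: (g \in _).
rewrite -natr_sum card_CR TI_cardMg ?stabTI // natrM.
by rewrite (mulrC #|C|%:R) mulKf ?mulVf ?neq0CG.
Qed.

End WellDefined.

Lemma irr_symP n mu (i : Iirr [set: 'S_n]) : is_part n mu ->
  (i \in irr_constt (ind_row n mu)) && (i \in irr_constt (ind_col n mu))
    = (i == irr_sym n mu).
Proof.
case/and3P=> mu_sorted _ /eqP sum_mu.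
have lt_mu (x : 'I_n) : (x < sumn mu)%N by rewrite sum_mu.
have: '[ind_row n mu, ind_col n mu] = 1.
  apply: cfdot_ind_fiber_stab => [x | x y [Er Ec] | x i0 le_i].
  - by apply: leq_trans (leq_subr _ _) (ltnW (ltn_ord x)).
  - apply: val_inj.
    by rewrite /= -(reshape_indexK mu x) -(reshape_indexK mu y) -/(tab_row mu x)
      -/(tab_col mu x) Er Ec.
  have lt_c : (tab_col mu x < nth 0%N mu i0)%N.
    apply: leq_trans (reshape_offsetP (lt_mu x)) _.
    have lt_r := reshape_indexP (lt_mu x).
    apply: (sorted_leq_nth _ _ _ mu_sorted) => //.
    + by move=> a b c /= ba cb; apply: leq_trans cb ba.
    + exact: leqnn.
    + exact: leq_ltn_trans lt_r.
  have lt_y := flatten_indexP lt_c; rewrite sum_mu in lt_y.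
  exists (Ordinal lt_y); [exact: flatten_indexKl | exact: flatten_indexKr].
have row_char : ind_row n mu \is a character by rewrite cfInd_char ?cfun1_char.
have col_char : ind_col n mu \is a character.
  by rewrite cfInd_char ?cfRes_char ?cfRepr_char.
rewrite cfdot_sum_irr => /natr_sum_eq1[j _ | j [_ Dj j0]].
  by rewrite rpredM ?conj_natr ?Cnat_cfdot_char_irr.
have common l : (l \in irr_constt (ind_row n mu))
    && (l \in irr_constt (ind_col n mu)) = (l == j).
  rewrite !irr_consttE -(conjC_eq0 '[ind_col _ _, _]) -negb_or -mulf_eq0.
  by have [-> | /j0->//] := eqVneq l j; rewrite ?Dj ?oner_eq0 ?eqxx.
rewrite common /irr_sym (eq_pick common).
by case: pickP => [l /eqP-> | /(_ j)] //=; rewrite eqxx.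
Qed.

(* Main.v *)
(* Let s have cycle type rho_k and let p_i be a point of its cycle of length i.
   Consider the function on S_n
     a = sum_u sgn(u) 1_{Y_u},
   where u runs over the labellings of the n points by k labels that give p_i
   the label i and use the labels with multiplicities t(1), ..., t(k) for some
   permutation t of 1, ..., k, where sgn(u) = sgn(t), and where Y_u is the Young
   subgroup fixing u.
   - As the Y_u are conjugate to the row stabilizer, a is orthogonal to all
     matrix coefficients of the irreducible characters that do not occur in the
     permutation character on its cosets.
   - a is supported on the class of s: if a(w) <> 0 then the orbits of the p_i
     under w have distinct sizes, since otherwise swapping two labels outside of
     these orbits is a sign-reversing involution; such sizes can only be
     1, ..., k.  Moreover a(s) = 1.
   - Hence a is proportional to its product with the sign character, so it is
     also orthogonal to the irreducible characters that do not occur in the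
     signed permutation character of the column stabilizer.
   So a is a matrix coefficient of [rho_k], and a^2 is one of [rho_k]^2.  If
   [mu] were not a constituent of the latter, then a^2 would be orthogonal to
   [mu], but this inner product is [mu](s) times a positive number. *)
Require Import Defs.
From mathcomp Require Import all_boot all_order all_algebra all_fingroup.
From mathcomp Require Import all_solvable all_field all_character.
From mathcomp Require Import ring.

Set Implicit Arguments.
Unset Strict Implicit.
Unset Printing Implicit Defensive.

Import GroupScope GRing.Theory Num.Theory.
Local Open Scope ring_scope.

(** * Idempotents of group algebras and orthogonality *)

(** The trace of an idempotent is its rank: exchanging the factors of a rank factorization gives an
    identity matrix. *)
Lemma idempotent_trace0 (F : numFieldType) n (P : 'M[F]_n) :
  P *m P = P -> \tr P = 0 -> P = 0.
Proof.
move=> idP; rewrite -{1}[P]mulmx_base mxtrace_mulC.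
have -> : row_base P *m col_base P = 1%:M.
  apply: (row_full_inj (col_base_full P)).
  apply: (row_free_inj (row_base_free P)).
  by rewrite /= mulmxA -mulmxA !mulmx_base mulmx1 mulmx_base.
by rewrite mxtrace1 => /eqP; rewrite pnatr_eq0 mxrank_eq0 => /eqP.
Qed.

Lemma big_group_mull (gT : finGroupType) (G : {group gT}) (V : nmodType)
    (F : gT -> V) x : x \in G -> \sum_(y in G) F (x * y)%g = \sum_(y in G) F y.
Proof.
move=> Gx; rewrite [RHS](reindex_inj (mulgI x)).
by apply: eq_bigl => y; rewrite groupMl.
Qed.

Lemma repr_idempotent_trace0 (gT : finGroupType) (G : {group gT}) n
    (rG : mx_representation algC G n) (f : gT -> algC) :
    {in G, forall x, \sum_(y in G) f y * f (y^-1 * x)%g = f x} ->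
    \sum_(x in G) f x * cfRepr rG x = 0 ->
  \sum_(x in G) f x *: rG x = 0.
Proof.
move=> idf trf; apply: idempotent_trace0; last first.
  rewrite raddf_sum -[RHS]trf; apply: eq_bigr => x Gx.
  by rewrite /= linearZ cfunE Gx.
rewrite mulmx_suml; under eq_bigr => y Gy.
  rewrite mulmx_sumr -(@big_group_mull _ _ _ _ y^-1%g) ?groupV //.
  under eq_bigr => x Gx.
    rewrite -scalemxAl -scalemxAr scalerA -repr_mxM ?groupM ?groupV // mulKVg.
    over.
  over.
rewrite exchange_big; apply: eq_bigr => x Gx.
by rewrite -scaler_suml idf.
Qed.

(** The idempotent of [xi] in the group algebra of [H] has as its trace on ['Chi_i] the multiplicity
    of [xi], here 0, so it acts as zero. *)
Lemma lin_char_orthogonal_coset (gT : finGroupType) (G H : {group gT})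
    (xi : 'CF(H)) (i : Iirr G) :
    H \subset G -> xi \is a linear_char -> '['Res[H] 'chi_i, xi] = 0 ->
  {in G, forall g, \sum_(h in H) (xi h)^* * 'chi_i (h * g)%g = 0}.
Proof.
move=> sHG lin_xi orth g Gg; pose rH := subg_repr 'Chi_i sHG.
have H0 : #|H|%:R != 0 :> algC by apply: neq0CG.
have: \sum_(h in H) (#|H|%:R^-1 * (xi h)^* ) *: rH h = 0.
  apply: repr_idempotent_trace0 => [x Hx|]; last first.
    rewrite -[RHS]orth cfdotE mulr_sumr; apply: eq_bigr => h Hh.
    rewrite -mulrA [(xi h)^* * _]mulrC; congr (_ * (_ * _)).
    by rewrite cfResE // -irrRepr !cfunE Hh (subsetP sHG).
  under eq_bigr => y Hy.
    rewrite mulrACA -rmorphM -lin_charM ?groupM ?groupV // mulKVg.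
    over.
  by rewrite sumr_const -[LHS]mulr_natl !mulrA mulfV // mul1r.
move/(congr1 (fun P => \tr (#|H|%:R *: P *m 'Chi_i g))).
rewrite scaler0 mul0mx mxtrace0 scaler_sumr mulmx_suml raddf_sum => tr0.
rewrite -[RHS]tr0; apply: eq_bigr => h Hh.
rewrite scalerA mulrA mulfV // mul1r -scalemxAl /= linearZ /=.
have -> : rH h = 'Chi_i h by [].
have Gh := subsetP sHG h Hh.
by rewrite -repr_mxM // -(irrRepr i) cfunE groupM.
Qed.

(* [a] is a matrix coefficient of 'chi_i, so that [a ^+ 2] is one of the
   Kronecker square. *)
Lemma matrix_coef_orthogonal (gT : finGroupType) (G : {group gT})
    (i m : Iirr G) (a : gT -> algC) :
    (forall j, j != i ->
      {in G, forall g, \sum_(h in G) a h * 'chi_j (h^-1 * g)%g = 0}) ->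
    m \notin irr_constt ('chi_i ^+ 2) ->
  \sum_(g in G) 'chi_m g^-1%g * a g ^+ 2 = 0.
Proof.
move=> a0 m0.
(* [A] is the Fourier coefficient of [a] at [i]; the others vanish, so Fourier inversion recovers
   [a] from it. *)
pose A := (#|G|%:R^-1 * 'chi_i 1%g) *: \sum_(h in G) a h *: 'Chi_i h^-1%g.
have aE : {in G, forall g, a g = \tr (A *m 'Chi_i g)}.
  move=> g Gg; have G0 : #|G|%:R != 0 :> algC by apply: neq0CG.
  have: \sum_(h in G) a h * cfReg G (h^-1 * g)%g = a g * #|G|%:R.
    rewrite (bigD1 g) //= mulVg cfRegE eqxx big1 ?addr0 // => h /andP[_ hg].
    by rewrite cfRegE -eq_mulVg1 (negPf hg) mulr0.
  move=> reg; rewrite -[LHS](mulfK G0) -{}reg mulrC.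
  under eq_bigr => h Gh.
    rewrite cfReg_sum sum_cfunE mulr_sumr.
    under eq_bigr => j _ do rewrite cfunE mulrCA.
    over.
  rewrite exchange_big (bigD1 i) //= [X in _ + X]big1 ?addr0; last first.
    by move=> j ji; rewrite -mulr_sumr a0 ?mulr0.
  rewrite -mulr_sumr -scalemxAl linearZ /= mulrA; congr (_ * _).
  rewrite mulmx_suml raddf_sum; apply: eq_bigr => h Gh.
  rewrite /= -scalemxAl linearZ /= -repr_mxM ?groupV //.
  by rewrite -(irrRepr i) cfunE groupM ?groupV.
pose rG := prod_repr 'Chi_i 'Chi_i.
have G0 : #|G|%:R != 0 :> algC by apply: neq0CG.
(* The central idempotent of ['chi_m] acts as zero on the tensor square; pairing it with [tprod A A]
   then yields the sum with [a g ^+ 2]. *)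
have: \sum_(g in G) (#|G|%:R^-1 * 'chi_m 1%g * 'chi_m g^-1%g) *: rG g = 0.
  apply: repr_idempotent_trace0 => [x Gx|].
    under eq_bigr => y Gy.
      rewrite mulrACA invMg invgK [_ * 'chi_m (x^-1 * y)%g]mulrC.
      rewrite -(@cfunJ _ _ 'chi_m (x^-1 * y)%g x^-1%g) ?groupV //.
      rewrite conjgE invgK !mulgA mulgV mul1g.
      over.
    rewrite -mulr_sumr -mulrA mulrACA.
    have := generalized_orthogonality_relation x^-1%g m m.
    rewrite eqxx mul1r => /(canRL (mulKf (invr_neq0 G0)))->.
    by field; rewrite irr1_neq0 G0.
  move: m0; rewrite irr_consttE negbK cfdotE => /eqP m0.
  rewrite -[RHS](mulr0 ('chi_m 1%g)) -[in RHS]m0 !mulr_sumr.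
  apply: eq_bigr => g Gg.
  rewrite -cfRepr_prod irrRepr cfunE -(char_inv _ (irr_char m)).
  by ring.
move/(congr1 (fun P => \tr (tprod A A *m P))).
rewrite mulmx0 mxtrace0 mulmx_sumr raddf_sum => tr0.
apply: (mulfI (mulf_neq0 (invr_neq0 G0) (irr1_neq0 m))).
rewrite mulr0 mulr_sumr -[RHS]tr0; apply: eq_bigr => g Gg.
by rewrite /= -scalemxAr linearZ /= -tprodE mxtrace_prod -aE // expr2 !mulrA.
Qed.

(** * Signed sums over labellings *)

(* The determinant is sgn(u), and 0 for the labellings whose multiplicities are
   not a permutation of 1, ..., k.  Labels are counted from 0. *)
Definition label_mx n k (u : {ffun 'I_n -> 'I_k}) : 'M[algC]_k :=
  \matrix_(i, j) (#|[set x | u x == i]| == j.+1)%:R.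

Definition stable_labelling n k (p : 'I_k -> 'I_n) (w : 'S_n)
    (u : {ffun 'I_n -> 'I_k}) : bool :=
  [forall i, u (p i) == i] && (w \in fiber_stab (fun x => u x)).

(* The function a above. *)
Definition young_sum n k (p : 'I_k -> 'I_n) (w : 'S_n) : algC :=
  \sum_(u | stable_labelling p w u) \det (label_mx u).

Lemma porbit_stab n k (u : {ffun 'I_n -> 'I_k}) (w : 'S_n) x y :
  w \in fiber_stab (fun x => u x) -> y \in porbit w x -> u y = u x.
Proof.
move/fiber_stabP=> uw /porbitP[m ->].
by elim: m => [|m IHm]; rewrite ?perm1 // expgSr permM -IHm; apply/val_inj/uw.
Qed.

Lemma mem_porbit_perm (T : finType) (w : {perm T}) x y :
  (w x \in porbit w y) = (x \in porbit w y).
Proof. by rewrite -!eq_porbit_mem -{1}(porbit_perm w 1 x) expg1. Qed.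

(* Exchanging the labels [i] and [i'] outside the orbits of all the points [p l]
   is a sign-reversing involution. *)
Lemma young_sum_eq0 n k (p : 'I_k -> 'I_n) (w : 'S_n) i i' :
    i != i' -> #|porbit w (p i)| = #|porbit w (p i')| ->
  young_sum p w = 0.
Proof.
move=> ii' eqc; set t := tperm i i'.
pose O := [set x | [exists l, x \in porbit w (p l)]].
have Op l : p l \in O by rewrite inE; apply/existsP; exists l; apply: porbit_id.
have Ow x : (w x \in O) = (x \in O).
  by rewrite !inE; under eq_existsb => l do rewrite mem_porbit_perm.
pose th (u : {ffun 'I_n -> 'I_k}) :=
  [ffun x => if x \in O then u x else t (u x)].
have thK : involutive th.
  move=> u; apply/ffunP=> x; rewrite !ffunE /t.
  by case: (x \in O); rewrite ?tpermK.
suff: young_sum p w = - young_sum p w.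
  by move/eqP; rewrite -addr_eq0 -mulr2n mulrn_eq0 => /eqP.
have th_ok u : stable_labelling p w (th u) = stable_labelling p w u.
  have imp v : stable_labelling p w v -> stable_labelling p w (th v).
    case/andP=> /forallP vp /fiber_stabP vw.
    apply/andP; split; first by apply/forallP=> l; rewrite ffunE Op.
    apply/fiber_stabP=> x; rewrite !ffunE Ow.
    by rewrite (val_inj (vw x) : v (w x) = v x).
  by apply/idP/idP=> [/(imp (th u)) | /(imp u) //]; rewrite thK.
rewrite {1}/young_sum (reindex_inj (inv_inj thK)) /= -sumrN.
apply: eq_big => [u | u]; rewrite th_ok // => /andP[/forallP up uw].
have orbE (v : {ffun 'I_n -> 'I_k}) l : (forall x, x \in O -> v x = u x) ->
    [set x | v x == l] :&: O = porbit w (p l).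
  move=> vu; apply/setP=> x; rewrite in_setI in_set.
  apply/andP/idP=> [[/eqP vx Ox] | xl].
    have := Ox; rewrite inE => /existsP[m xm].
    by move: vx; rewrite vu // (porbit_stab uw xm) (eqP (up m)) => <-.
  have Ox : x \in O by rewrite inE; apply/existsP; exists l.
  by rewrite vu // (porbit_stab uw xl) up.
(* Inside [O] the fibre of [l] is the orbit of [p l], and those of [i] and [i'] have equal size, so
   [th] just swaps two rows. *)
have -> : label_mx (th u) = perm_mx t *m label_mx u.
  rewrite -row_permE; apply/matrixP=> l j; rewrite !mxE; congr (_ == _)%:R.
  rewrite -(cardsID O) -[RHS](cardsID O) !orbE //; last first.
    by move=> x Ox; rewrite ffunE Ox.
  congr (_ + _)%N.
    by rewrite /t; case: tpermP => [->|->|].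
  congr #|pred_of_set _|; apply/setP=> x; rewrite !in_setD.
  case: (boolP (x \in O)) => //= xO.
  rewrite !in_set ffunE (negPf xO).
  by rewrite -(inj_eq (@perm_inj _ t)) tpermK.
by rewrite det_mulmx det_perm odd_tperm ii' /= expr1 mulN1r.
Qed.

Definition staircase_cycles n k (w : 'S_n) (p : 'I_k -> 'I_n) :=
  forall i, #|porbit w (p i)| = i.+1.

(** The orbits lie in distinct fibres of a stable labelling, so their distinct sizes sum to at most
    [n], which leaves only 1, ..., k. *)
Lemma young_sum_neq0 n k (p : 'I_k -> 'I_n) (w : 'S_n) :
    (\sum_(i < k) i.+1 = n)%N -> young_sum p w != 0 ->
  exists q : 'I_k -> 'I_n, staircase_cycles w q.
Proof.
move=> sum_n nz; pose c i := #|porbit w (p i)|.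
have c0 i : (0 < c i)%N by rewrite lt0n card_porbit_neq0.
have inj_c : injective c.
  move=> i i' eqc; apply: contraNeq nz => ii'.
  by rewrite (young_sum_eq0 ii').
have [u /andP[/forallP up uw] | no_u] := pickP (stable_labelling p w);
  last first.
  by rewrite /young_sum big_pred0 ?eqxx in nz.
have le_c : (\sum_i c i <= n)%N.
  rewrite -[leqRHS]card_ord -sum1_card (partition_big u predT) //=.
  apply: leq_sum => i _; rewrite sum1_card subset_leq_card //.
  by apply/subsetP=> x /(porbit_stab uw); rewrite (eqP (up i)) => /eqP.
(* [sum_uniq_iota] counts from 0, hence the predecessors; its equality case bounds them by [k]. *)
pose s := [seq (c i).-1 | i <- enum 'I_k].
have Us : uniq s.
  rewrite map_inj_uniq ?enum_uniq // => i j eq_ij; apply: inj_c.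
  by rewrite -(prednK (c0 i)) eq_ij prednK.
have sz : size s = k by rewrite size_map size_enum_ord.
have [le_s eq_s] := sum_uniq_iota Us; rewrite sz in le_s eq_s.
have lt_c i : ((c i).-1 < k)%N.
  suff /allP: all (ltn^~ k) s.
    by apply; apply/mapP; exists i; rewrite ?mem_enum.
  rewrite -eq_s eqn_leq le_s /= sumnE big_map big_enum /=.
  rewrite -(leq_add2r (\sum_(i < k) 1)) -!big_split /=.
  under eq_bigr => j _ do rewrite addn1 prednK //.
  by under [leqRHS]eq_bigr => j _ do rewrite addn1; rewrite sum_n.
have inj_f : injective (fun i => Ordinal (lt_c i)).
  move=> i j /(congr1 val) /= eq_ij; apply: inj_c.
  by rewrite -(prednK (c0 i)) eq_ij prednK.
exists (fun i => p (invF inj_f i)) => i.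
by rewrite -{2}(f_invF inj_f i) /= prednK.
Qed.

(** * Permutations with cycles of lengths 1, ..., k *)

Lemma eq_permX_porbit (T : finType) (w : {perm T}) x a b :
  ((w ^+ a)%g x == (w ^+ b)%g x) = (a == b %[mod #|porbit w x|]).
Proof.
set c := #|porbit w x|; have c0 : (0 < c)%N by rewrite lt0n card_porbit_neq0.
have red m : (w ^+ m)%g x = nth x (traject w x c) (m %% c).
  rewrite nth_traject ?ltn_mod // {1}(divn_eq m c) permX addnC iterD.
  congr iter; elim: (m %/ c)%N => // d IHd.
  by rewrite mulSn iterD IHd iter_porbit.
by rewrite !red nth_uniq ?size_traject ?ltn_mod ?uniq_traject_porbit.
Qed.

Section StaircaseCycles.

Variables (n k : nat).
Implicit Types (w s : 'S_n) (p q : 'I_k -> 'I_n).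
Hypothesis sum_n : (\sum_(i < k) i.+1 = n)%N.

(** Orbits of different sizes are disjoint, and these sizes add up to the number of points. *)
Lemma staircase_cycles_cover w p :
  staircase_cycles w p -> forall x, exists i, x \in porbit w (p i).
Proof.
move=> wp x; pose P := [set porbit w (p i) | i : 'I_k].
have inj_p : injective (fun i => porbit w (p i)).
  move=> i j /(congr1 (fun A => #|pred_of_set A|)) /=; rewrite !wp => -[].
  exact: val_inj.
have tiP : trivIset P.
  apply/trivIsetP=> _ _ /imsetP[i _ ->] /imsetP[j _ ->]; apply: contraR.
  case/pred0Pn=> y /andP[/= yi yj]; apply/eqP.
  by move: yi yj; rewrite -!eq_porbit_mem => /eqP <- /eqP.
have : x \in cover P.
  suff -> : cover P = setT by rewrite inE.
  apply/eqP; rewrite eqEcard subsetT cardsT card_ord.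
  move: tiP; rewrite /trivIset => /eqP <-.
  rewrite big_imset /=; last by move=> i j _ _; apply: inj_p.
  by under eq_bigr => i _ do rewrite wp; rewrite -sum_n.
by rewrite /cover => /bigcupP[_ /imsetP[i _ ->] xi]; exists i.
Qed.

(** Either equation means that [i = j] and that [a] and [b] agree modulo the cycle length, whatever
    the permutation. *)
Lemma staircase_cycles_transport w s p q i j a b :
    staircase_cycles w p -> staircase_cycles s q ->
  (w ^+ a)%g (p i) = (w ^+ b)%g (p j) -> (s ^+ a)%g (q i) = (s ^+ b)%g (q j).
Proof.
move=> wp sq eq_x; have eq_ij : i = j.
  move/(congr1 (fun x => #|porbit w x|)): eq_x.
  by rewrite !porbit_perm !wp => -[] /val_inj.
move/eqP: eq_x; rewrite -eq_ij => eq_x; apply/eqP.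
by move: eq_x; rewrite !eq_permX_porbit wp sq.
Qed.

Lemma staircase_cycles_conj w s p q :
  staircase_cycles w p -> staircase_cycles s q -> exists h, s = (w ^ h)%g.
Proof.
move=> wp sq.
have /fin_all_exists[d Dd] x :
    exists im : 'I_k * nat, x = (w ^+ im.2)%g (p im.1).
  have [i /porbitP[m Dx]] := staircase_cycles_cover wp x.
  by exists (i, m).
(* The conjugator matches cycles of equal length; transport one way gives [fE], the other way
   injectivity. *)
pose f x := (s ^+ (d x).2)%g (q (d x).1).
have fE i m : f ((w ^+ m)%g (p i)) = (s ^+ m)%g (q i).
  by apply: (staircase_cycles_transport wp sq); rewrite -Dd.
have inj_f : injective f.
  by move=> x y /(staircase_cycles_transport sq wp); rewrite -!Dd.
exists (perm inj_f); apply/permP=> y.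
rewrite -[y](permKV (perm inj_f)); move: (_ y) => x.
by have := fE (d x).1 (d x).2.+1; rewrite !expgSr !permM -Dd permK !permE.
Qed.

(** The only stable labelling marks each point by its cycle, and its matrix is the identity. *)
Lemma young_sum_self w p : staircase_cycles w p -> young_sum p w = 1.
Proof.
move=> wp; have /fin_all_exists[d Dd] := staircase_cycles_cover wp.
pose u : {ffun 'I_n -> 'I_k} := finfun d.
have dE x i : x \in porbit w (p i) -> d x = i.
  move=> xi; apply: val_inj; apply: succn_inj; rewrite -!wp.
  by move: xi (Dd x); rewrite -!eq_porbit_mem => /eqP <- /eqP ->.
rewrite /young_sum (big_pred1 u) => [|v].
  rewrite (_ : label_mx u = 1%:M) ?det1 //; apply/matrixP=> i j.
  have -> : 1%:M i j = (#|porbit w (p i)| == j.+1)%:R :> algC.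
    by rewrite mxE wp eqSS.
  rewrite mxE; congr (_ == _)%:R; apply: eq_card => x; rewrite !inE ffunE.
  by apply/eqP/idP=> [<- | /dE].
apply/andP/eqP=> [[/forallP vp vw] | ->].
  by apply/ffunP=> x; rewrite ffunE (porbit_stab vw (Dd x)); apply/eqP.
split; first by apply/forallP=> i; rewrite ffunE (dE _ i) ?porbit_id.
apply/fiber_stabP=> x; rewrite !ffunE; congr (val _).
by apply: dE; rewrite mem_porbit_perm.
Qed.

End StaircaseCycles.

(** * Rows and columns of the staircase tableau *)

Definition fiber n (f : 'I_n -> nat) r := [set x | f x == r].

Lemma sum_staircase k : (\sum_(i < k) i.+1 = (k * k.+1) %/ 2)%N.
Proof.
have <- : ('C(k.+1, 2) = (k * k.+1) %/ 2)%N by rewrite bin2 /= mulnC divn2.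
by rewrite -bin2_sum big_mkord big_ord_recl.
Qed.

Lemma sumn_staircase k : (sumn (staircase k) = \sum_(i < k) i.+1)%N.
Proof.
rewrite sumn_rev sumnE -(big_mkord predT succn) /index_iota subn0.
by rewrite (iotaDl 1 0) big_map.
Qed.

Lemma nth_staircase k r : nth 0%N (staircase k) r = (k - r)%N.
Proof.
have [le_kr | lt_rk] := leqP k r.
  by rewrite nth_default ?size_rev ?size_iota // (eqP le_kr).
by rewrite nth_rev ?size_iota // nth_iota ?add1n subnSK // leq_subr.
Qed.

Lemma is_part_staircase n k :
  (\sum_(i < k) i.+1 = n)%N -> is_part n (staircase k).
Proof.
move=> sum_n; apply/and3P; split.
- by rewrite rev_sorted iota_sorted.
- by rewrite mem_rev mem_iota.
by rewrite sumn_staircase sum_n.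
Qed.

Lemma card_staircase_row n k r : (\sum_(i < k) i.+1 = n)%N ->
  #|fiber (@tab_row n (staircase k)) r| = (k - r)%N.
Proof.
move=> sum_n; pose F (c : 'I_(k - r)) := flatten_index (staircase k) r c.
have lt_c (c : 'I_(k - r)) : (c < nth 0%N (staircase k) r)%N.
  by rewrite nth_staircase.
have ltF c : (F c < n)%N by rewrite -sum_n -sumn_staircase flatten_indexP.
have inj_F : injective (fun c => Ordinal (ltF c)).
  move=> c c' /(congr1 (fun x => tab_col (staircase k) x)).
  by rewrite /tab_col !flatten_indexKr //; apply: val_inj.
rewrite -[RHS]card_ord -(card_imset _ inj_F); apply: eq_card => x.
rewrite inE; apply/eqP/imsetP=> [rx | [c _ ->]]; last exact: flatten_indexKl.
have lt_x : (tab_col (staircase k) x < k - r)%N.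
  rewrite -rx -nth_staircase reshape_offsetP //.
  by rewrite sumn_staircase sum_n.
exists (Ordinal lt_x) => //; apply: val_inj.
by rewrite /= /F /= -rx reshape_indexK.
Qed.

(** The staircase is self-conjugate: [c < k - r] iff [r < k - c]. *)
Lemma card_staircase_col n k c : (\sum_(i < k) i.+1 = n)%N ->
  #|fiber (@tab_col n (staircase k)) c| = (k - c)%N.
Proof.
move=> sum_n; pose F (r : 'I_(k - c)) := flatten_index (staircase k) r c.
have lt_c (r : 'I_(k - c)) : (c < nth 0%N (staircase k) r)%N.
  by rewrite nth_staircase ltn_subCr.
have ltF r : (F r < n)%N by rewrite -sum_n -sumn_staircase flatten_indexP.
have inj_F : injective (fun r => Ordinal (ltF r)).
  move=> r r' /(congr1 (fun x => tab_row (staircase k) x)).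
  by rewrite /tab_row !flatten_indexKl //; apply: val_inj.
rewrite -[RHS]card_ord -(card_imset _ inj_F); apply: eq_card => x.
rewrite inE; apply/eqP/imsetP=> [cx | [r _ ->]]; last exact: flatten_indexKr.
have lt_x : (tab_row (staircase k) x < k - c)%N.
  rewrite -cx ltn_subCr -nth_staircase reshape_offsetP //.
  by rewrite sumn_staircase sum_n.
exists (Ordinal lt_x) => //; apply: val_inj.
by rewrite /= /F /= -cx reshape_indexK.
Qed.

Lemma eq_fiber_perm n (f f' : 'I_n -> nat) :
  (forall r, #|fiber f r| = #|fiber f' r|) -> exists g : 'S_n, f \o g =1 f'.
Proof.
move=> eq_ff'; have /tuple_permP[g Dg] :
    perm_eq [tuple f' i | i < n] [tuple f i | i < n].
  apply/allP=> r _ /=; rewrite !count_map; apply/eqP.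
  have cnt (h : 'I_n -> nat) :
      count (preim h (pred1 r)) (enum 'I_n) = #|fiber h r|.
    rewrite cardE -size_filter {2}/enum_mem -enumT.
    by congr size; apply: eq_filter => x; rewrite !inE.
  by rewrite -!enumT; apply: etrans (cnt f') _; rewrite -eq_ff' -cnt.
exists g => x; have /(congr1 (fun t => tnth t x)) := val_inj Dg.
by rewrite !tnth_mktuple.
Qed.

(** * Orthogonality of the Young sum to irreducible characters *)

Lemma cfSgn_lin_char n : cfSgn n \is a linear_char.
Proof. by rewrite qualifE /= cfRepr_char cfRepr1 eqxx. Qed.

(** Equal fibre sizes make the stabilizers conjugate, and Frobenius reciprocity moves the hypothesis
    to a restriction of ['chi_j]. *)
Lemma fiber_stab_orthogonal n (f f' : 'I_n -> nat) (xi : 'CF([set: 'S_n])) j :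
    (forall r, #|fiber f r| = #|fiber f' r|) -> xi \is a linear_char ->
    '['chi_j, 'Ind[[set: 'S_n], fiber_stab_group f] ('Res xi)] = 0 ->
  forall g, \sum_(h in fiber_stab f') (xi h)^* * 'chi_j (h * g)%g = 0.
Proof.
move=> /eq_fiber_perm[q Dq] lin_xi; rewrite -cfdot_Res_l => orth g.
have stabJ h : (h ^ q^-1 \in fiber_stab f')%g = (h \in fiber_stab f).
  apply/fiber_stabP/fiber_stabP=> fh x.
    by have := fh (q^-1%g x); rewrite -!Dq /= conjgE invgK !permM !permKV.
  by rewrite -!Dq /= conjgE invgK !permM permKV fh.
rewrite (reindex_inj (conjg_inj q^-1%g)) (eq_bigl _ _ stabJ).
have sub : fiber_stab_group f \subset [set: 'S_n] by apply: subsetT.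
rewrite -[RHS](lin_char_orthogonal_coset sub (cfRes_lin_char _ lin_xi) orth
  (in_setT (g ^ q)%g)).
apply: eq_bigr => h fh; rewrite cfResE // cfunJ ?in_setT //; congr (_ * _).
by rewrite -[in LHS](conjgK q g) -conjMg cfunJ ?in_setT.
Qed.

(** A nonzero Leibniz term gives [t] with fibre sizes [t i + 1]; relabelling by [t] and reversing
    puts them in decreasing order. *)
Lemma det_label_mx_fiber n k (u : {ffun 'I_n -> 'I_k}) :
    \det (label_mx u) != 0 ->
  exists2 f : 'I_n -> nat, fiber_stab f = fiber_stab (fun x => u x)
    & forall r, #|fiber f r| = (k - r)%N.
Proof.
move=> nz; have [t /forallP tP] :
    exists t : 'S_k, [forall i, #|[set x | u x == i]| == (t i).+1].
  apply/existsP; apply: contraNT nz => /existsPn no_t.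
  rewrite /determinant big1 // => t _; have /forallPn[i Ni] := no_t t.
  by rewrite (bigD1 i) //= mxE (negPf Ni) mul0r mulr0.
exists (fun x => rev_ord (t (u x))) => [|r].
  apply/setP=> w; rewrite !inE; apply: eq_forallb => x.
  by rewrite !val_eqE (inj_eq rev_ord_inj) (inj_eq perm_inj).
have [le_kr | lt_rk] := leqP k r.
  rewrite (eqP le_kr); apply: eq_card0 => x; rewrite inE; apply/negP=> /eqP Dr.
  by have := ltn_ord (rev_ord (t (u x))); rewrite Dr ltnNge le_kr.
have /eqP := tP (t^-1%g (rev_ord (Ordinal lt_rk))).
rewrite permKV /= subnSK // => <-.
apply: eq_card => x; rewrite !inE -(inj_eq (@perm_inj _ t)) permKV.
by rewrite -(inj_eq rev_ord_inj) rev_ordK.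
Qed.

(** Each labelling with nonzero determinant contributes a vanishing coset sum. Trivial [xi] serves
    the rows, the sign the columns. *)
Lemma young_sum_orthogonal n k (p : 'I_k -> 'I_n) (f : 'I_n -> nat)
    (xi : 'CF([set: 'S_n])) j :
    (forall r, #|fiber f r| = (k - r)%N) -> xi \is a linear_char ->
    '['chi_j, 'Ind[[set: 'S_n], fiber_stab_group f] ('Res xi)] = 0 ->
  forall g, \sum_(h in [set: 'S_n])
    xi h * young_sum p h * 'chi_j (h^-1 * g)%g = 0.
Proof.
move=> Df lin_xi orth g.
rewrite (eq_bigl predT) => [|h]; last by rewrite in_setT.
under eq_bigr => h _ do rewrite /young_sum mulr_sumr mulr_suml big_mkcond.
rewrite exchange_big big1 // => u _.
have [-> | /det_label_mx_fiber[f' Df' cf']] := eqVneq (\det (label_mx u)) 0.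
  by apply: big1 => h _; rewrite mulr0 mul0r if_same.
rewrite -big_mkcond /stable_labelling.
have [up | _] := boolP [forall i, u (p i) == i]; last by rewrite big_pred0.
rewrite (reindex_inj invg_inj) /= -[RHS](mulr0 (\det (label_mx u))).
rewrite -[in RHS](fiber_stab_orthogonal (f' := f') _ lin_xi orth g); last first.
  by move=> r; rewrite Df cf'.
rewrite mulr_sumr; apply: eq_big => [h | h _]; first by rewrite -Df' groupV.
by rewrite invgK -lin_charV_conj ?in_setT // mulrCA mulrA.
Qed.

(** Integers are real, so the squares in the final sum cannot cancel. *)
Lemma young_sum_int n k (p : 'I_k -> 'I_n) w : young_sum p w \is a Num.int.
Proof.
apply: rpred_sum => u _; apply: rpred_sum => t _.
rewrite rpredM ?rpredX ?rpredN1 ?rpred1 // rpred_prod // => i _.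
by rewrite mxE rpred_nat.
Qed.

Lemma cycle_type_staircase n k (s : 'S_n) :
  cycle_type s = staircase k -> exists p : 'I_k -> 'I_n, staircase_cycles s p.
Proof.
move=> hs.
suff /fin_all_exists[p sp] (i : 'I_k) : exists x, #|porbit s x| = i.+1.
  by exists p.
have: i.+1 \in cycle_type s by rewrite hs mem_rev mem_iota /= add1n ltnS.
rewrite mem_sort => /mapP[C]; rewrite mem_enum => /imsetP[x _ ->] ->.
by exists x.
Qed.

Theorem corollary4p4 (k n : nat) (hk : (1 <= k)%N)
    (hn : n = ((k * k.+1) %/ 2)%N)
    (mu : seq nat) (hmu : is_part n mu)
    (s : 'S_n) (hs : cycle_type s = staircase k)
    (hmus : 'chi_(irr_sym n mu) s != 0) :
  irr_sym n mu \in irr_constt ('chi_(irr_sym n (staircase k)) ^+ 2).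
Proof.
have sum_n : (\sum_(i < k) i.+1 = n)%N by rewrite sum_staircase.
have [p sp] := cycle_type_staircase hs.
have a_conj w : young_sum p w != 0 -> exists h, w = (s ^ h)%g.
  case/(young_sum_neq0 sum_n) => q wq.
  exact: (staircase_cycles_conj sum_n sp wq).
apply: contraNT hmus; move/(matrix_coef_orthogonal (a := young_sum p)) => sum0.
have {sum0} : \sum_(g in [set: 'S_n])
    'chi_(irr_sym n mu) g^-1%g * young_sum p g ^+ 2 = 0.
  (* By uniqueness of the label, ['chi_j] is missing from [ind_row] or from [ind_col]. *)
  apply: sum0 => j; rewrite -(irr_symP _ (is_part_staircase sum_n)).
  rewrite negb_and !irr_consttE !negbK -!(conjC_eq0 '[_, 'chi_j]) -!cfdotC.
  case/orP=> /eqP orth g _.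
    have := young_sum_orthogonal p (fun r => card_staircase_row r sum_n)
      (cfun1_lin_char _) _ g.
    rewrite cfRes_cfun1 => /(_ j orth) sum0; rewrite -[RHS]sum0.
    by apply: eq_bigr => h _; rewrite cfun1E in_setT mul1r.
  have sum0 := young_sum_orthogonal p (fun r => card_staircase_col r sum_n)
    (cfSgn_lin_char n) orth g.
  (* The sign is constant on the class of [s], which supports [young_sum p], so it comes out as a
     nonzero factor. *)
  have sgn0 : (-1) ^+ s != 0 :> algC by rewrite signr_eq0.
  apply: (mulfI sgn0); rewrite mulr0 mulr_sumr -[RHS]sum0.
  apply: eq_bigr => h _; rewrite mulrA cfSgnE; congr (_ * _).
  have [-> | /a_conj[x ->]] := eqVneq (young_sum p h) 0.
    by rewrite !mulr0.
  by rewrite odd_permJ.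
under eq_bigr => g _.
  rewrite (_ : _ * _ = 'chi_(irr_sym n mu) s^-1%g * young_sum p g ^+ 2).
    over.
  have [-> | /a_conj[h ->]] := eqVneq (young_sum p g) 0.
    by rewrite expr0n !mulr0.
  by rewrite -conjVg cfunJ ?in_setT.
rewrite -mulr_sumr => /eqP; rewrite mulf_eq0 char_inv ?irr_char // conjC_eq0.
(* A vanishing sum of squares would force [young_sum p s = 0], but this value is 1. *)
case/orP=> //; rewrite psumr_eq0 => [/allP/(_ s)|g _]; last first.
  by rewrite real_exprn_even_ge0 // Rreal_int // young_sum_int.
rewrite mem_index_enum in_setT /= (young_sum_self sum_n) //.
by rewrite expr1n oner_eq0 => /(_ isT).
Qed.
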